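(* Let $N$ be the size of the ID space. Let $\mathcal{A}$ be a deterministic leader election algorithm in the $\mathsf{Strong}\text{-}\mathsf{CD}$ model that is correct for every set of devices $V \subseteq [N]$ with $|V| \ge n$, and let $k$ be its energy complexity. Then $k \geq \Omega(\log \log \frac{N}{n})$.
   Context: Single-hop radio network: a set $V$ of devices, each device $v$ having a distinct identifier $\mathsf{ID}(v) \in [N] = \{1,\dots,N\}$; $N$ and $n$ are known to all devices. Communication proceeds in synchronous time slots; in each slot each device (based on its ID, the known parameters and all feedback received so far) either stays idle, listens, or transmits a message. In the $\mathsf{Strong}\text{-}\mathsf{CD}$ model, transmitters and listeners receive silence if zero devices transmit, collision if at least two devices transmit, and the message if exactly one device transmits; idle devices receive nothing. Leader election: at termination exactly one device identifies itself as leader and all others as non-leaders. The energy complexity is the worst-case maximum over all devices of the number of time slots in which the device listens or transmits. *)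

(* Defs.v *)
From mathcomp Require Import all_boot all_order all_algebra.
From mathcomp Require Import reals exp.

Set Implicit Arguments.
Unset Strict Implicit.
Unset Printing Implicit Defensive.

Section RadioNetwork.

(* The message alphabet [M] is arbitrary: message size is not bounded. *)
Variable M : Type.

Inductive action : Type :=
  | Idle
  | Listen
  | Transmit of M
  | Terminate of bool. (* [true] for leader, [false] for non-leader *)

Inductive feedback : Type :=
  | Silence
  | Collision
  | Received of M.

Definition sent (a : action) : option M :=
  if a is Transmit m then Some m else None.

Definition awake (a : action) : bool :=
  match a with Listen | Transmit _ => true | Idle | Terminate _ => false end.

Variable N : nat.

(* A device is identified with its ID, and the ID space {1, ..., N} is encoded
   as 'I_N. The history of a device has one entry per elapsed slot ([None] for
   a slot spent idle), so it also records the time. The dependence on the known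
   parameters N and n is implicit: an algorithm is given for fixed N and n. *)
Definition history : Type := seq (option feedback).
Definition algorithm : Type := 'I_N -> history -> action.

Definition channel (V : {set 'I_N}) (act : 'I_N -> action) : feedback :=
  match pmap (fun v => sent (act v)) (enum V) with
  | [::] => Silence
  | [:: m] => Received m
  | _ => Collision
  end.

(* Strong-CD: transmitters get the same feedback as listeners. The history of a
   terminated device is frozen, hence so is its decision. *)
Definition extend (fb : feedback) (a : action) (h : history) : history :=
  match a with
  | Idle => rcons h None
  | Listen | Transmit _ => rcons h (Some fb)
  | Terminate _ => h
  end.

Variables (A : algorithm) (V : {set 'I_N}).

Fixpoint history_at (t : nat) : 'I_N -> history :=
  if t is s.+1 then
    let h := history_at s in
    let act v := A v (h v) in
    fun v => extend (channel V act) (act v) (h v)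
  else fun=> [::].

Definition action_at (t : nat) (v : 'I_N) : action := A v (history_at t v).

Definition elects_leader : Prop :=
  exists t : nat, exists2 l : 'I_N, l \in V &
    forall v, v \in V -> action_at t v = Terminate (v == l).

Definition energy (t : nat) (v : 'I_N) : nat :=
  \sum_(s < t) awake (action_at s v).

End RadioNetwork.

Definition correct (M : Type) (N n : nat) (A : algorithm M N) : Prop :=
  forall V : {set 'I_N}, n <= #|V| -> elects_leader A V.

(* [k] is the maximum, over the admissible device sets and their devices, of
   the energy spent. The maximum is also over time, as [energy] counts only the
   slots before time [t]; it is attained whenever [A] is correct and n <= N. *)
Definition energy_complexity (M : Type) (N n : nat) (A : algorithm M N)
    (k : nat) : Prop :=
  (forall (V : {set 'I_N}) (t : nat) (v : 'I_N),
     n <= #|V| -> v \in V -> energy A V t v <= k) /\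
  (exists (V : {set 'I_N}) (t : nat) (v : 'I_N),
     [/\ n <= #|V|, v \in V & energy A V t v = k]).

(* Main.v *)
(* Feed the devices with fictitious feedback that does not depend on who else is
   present: listeners hear silence, transmitters hear either their own message
   or, in slots declared colliding, a collision.  In each slot keep only one
   class of awake devices, all transmitting or all listening, and all of the same
   rank (defined below); a potential argument shows that a fraction
   1/2^O(k^2) of the ID space survives.  A set V of survivors is robust if in
   every slot it has at most one transmitter, or, when the slot is declared
   colliding, none or at least three.  On a robust set the fictitious run is the
   real one, even after removing the leader, so more than n devices cannot form
   one.
   To get a robust set, declare a slot colliding when it has at least about
   K^rank transmitters, where the rank of a history is its in-order index in the
   binary tree of histories, the collision branch being on the left.  For a single
   device, quiet transmission slots then have smaller rank than colliding ones,
   so conflicts in quiet slots are sparse compared with the size of the colliding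
   groups (those that have lost too many members can be discarded cheaply), and
   an independent transversal (Rosenfeld's counting argument) of the colliding
   groups, together with n + 1 further large groups, is robust.  As
   there are 2^(k+1) ranks, all this works once N/n is at least
   K^(2^(k+1)) * 2^O(k^2), with K = 2^O(k^2). *)
Require Import Defs.
From mathcomp Require Import all_boot all_order all_algebra.
From mathcomp Require Import zify ring lra.
From mathcomp Require Import reals exp.

Set Implicit Arguments.
Unset Strict Implicit.
Unset Printing Implicit Defensive.

Import Order.TTheory GRing.Theory Num.Theory.

(** * Independent transversals *)

Section IndependentTransversal.
Variables (I T : finType) (G : I -> {set T}) (e : rel T) (x0 : T).

(** A partial transversal on [S] is encoded as a total function pinned to [x0] outside [S], so that
    each is counted once. *)
Definition transversals (S : {set I}) : {set {ffun I -> T}} :=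
  [set f : {ffun I -> T} |
     [forall i, if i \in S then f i \in G i else f i == x0]
     && [forall i in S, forall j in S, ~~ e (f i) (f j)]].

Definition update (f : {ffun I -> T}) (i : I) (x : T) : {ffun I -> T} :=
  [ffun j => if j == i then x else f j].

Lemma transversalsP (S : {set I}) (f : {ffun I -> T}) :
  reflect [/\ forall i, i \in S -> f i \in G i, forall i, i \notin S -> f i = x0
            & forall i j, i \in S -> j \in S -> ~~ e (f i) (f j)]
          (f \in transversals S).
Proof.
rewrite inE; apply: (iffP andP) => [[/forallP fG /forall_inP fe]|[fG fx fe]]; split.
- by move=> i iS; have := fG i; rewrite iS.
- by move=> i /negPf iS; have := fG i; rewrite iS => /eqP.
- by move=> i j iS jS; have /forall_inP := fe i iS; apply.
- by apply/forallP => i; case: ifPn => iS; [apply: fG | apply/eqP/fx].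
- by apply/forall_inP => i iS; apply/forall_inP => j jS; apply: fe.
Qed.

(** A transversal is determined by its value at [j] and its restriction to [S :\ j], which is again
    a transversal. *)
Lemma card_transversals_through (S : {set I}) (x : T) (j : I) : j \in S ->
  #|[set f in transversals S | e x (f j)]|
    <= #|[set y in G j | e x y]| * #|transversals (S :\ j)|.
Proof.
move=> jS; rewrite -cardsX.
pose g (f : {ffun I -> T}) := (f j, update f j x0).
rewrite -(card_in_imset (f := g)); last first.
  move=> f1 f2; rewrite !inE => _ _ [fj /ffunP fu]; apply/ffunP => i.
  by have := fu i; rewrite !ffunE; case: eqP => [->|].
apply/subset_leq_card/subsetP => _ /imsetP [f + ->].
rewrite inE => /andP [/transversalsP [fG fx fe] exf].
rewrite !inE /= fG //= exf /=.
have: update f j x0 \in transversals (S :\ j).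
  apply/transversalsP; split.
  - by move=> i; rewrite !inE ffunE => /andP [/negPf -> /fG].
  - by move=> i; rewrite !inE ffunE negb_and negbK; case: eqP => //= _ /fx.
  - move=> i i'; rewrite !inE !ffunE => /andP [/negPf -> iS] /andP [/negPf -> i'S].
    exact: fe.
by rewrite inE.
Qed.

Hypothesis e_irr : irreflexive e.
Hypothesis e_sym : symmetric e.

(** Union bound: extending a transversal of [S :\ i] by [x] at [i] fails only if [x] conflicts with
    some value [f j]. *)
Lemma card_transversals_extend (S : {set I}) (i : I) : i \in S ->
  #|G i| * #|transversals (S :\ i)| <= #|transversals S|
   + \sum_(x in G i) \sum_(j in S :\ i)
       #|[set f in transversals (S :\ i) | e x (f j)]|.
Proof.
move=> iS; rewrite -cardsX.
pose B := setX (G i) (transversals (S :\ i)).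
pose g (p : T * {ffun I -> T}) := update p.2 i p.1.
rewrite -/B -(cardsID [set p | g p \in transversals S]).
apply: leq_add.
  rewrite -(card_in_imset (f := g)); last first.
    case=> x1 f1 [x2 f2]; rewrite !inE /= => /andP [/andP [_ f1S] _].
    move=> /andP [/andP [_ f2S] _] /ffunP gE.
    have xE : x1 = x2 by have := gE i; rewrite !ffunE eqxx.
    congr pair => //; apply/ffunP => j.
    have := gE j; rewrite !ffunE; case: eqP => // -> _.
    have /transversalsP [_ h1 _]: f1 \in transversals (S :\ i) by rewrite inE.
    have /transversalsP [_ h2 _]: f2 \in transversals (S :\ i) by rewrite inE.
    by rewrite h1 ?h2 // !inE eqxx.
  apply/subset_leq_card/subsetP => _ /imsetP [p + ->].
  by rewrite 2!inE => /andP [].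
have -> : \sum_(x in G i) \sum_(j in S :\ i)
            #|[set f in transversals (S :\ i) | e x (f j)]|
   = \sum_(p in B) \sum_(j in S :\ i) e p.1 (p.2 j).
  rewrite (eq_bigl (fun p => (p.1 \in G i) && (p.2 \in transversals (S :\ i)))); last first.
    by case=> x f; rewrite in_setX.
  rewrite -(pair_big (fun x => x \in G i) (fun f => f \in transversals (S :\ i))
     (fun x f => \sum_(j in S :\ i) (e x (f j) : nat))) /=.
  apply: eq_bigr => x _; rewrite exchange_big /=; apply: eq_bigr => j _.
  rewrite -sum1_card big_mkcond [RHS]big_mkcond /=; apply: eq_bigr => f _.
  by rewrite inE; case: (f \in _) => //=; case: (e _ _).
rewrite -sum1_card big_mkcond [leqRHS]big_mkcond /=; apply: leq_sum => p _.
rewrite in_setD; case pB: (p \in B); rewrite ?andbF // andbT.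
case: ifP => //; rewrite inE => gS.
case: (posnP (\sum_(j in S :\ i) e p.1 (p.2 j))) => // /eqP; rewrite sum_nat_eq0.
move=> /forall_inP e0; case/negP: gS.
case: p pB e0 => x f; rewrite in_setX /= => /andP [xG /transversalsP [fG fx fe]] e0.
have e0' j : j != i -> j \in S -> e x (f j) = false.
  by move=> ji jS; apply/negbTE; rewrite -eqb0; apply: e0; rewrite !inE ji.
apply/transversalsP; split.
- by move=> j jS; rewrite ffunE; case: eqP => [->//|/eqP ji]; rewrite fG // !inE ji.
- move=> j jS; rewrite ffunE; case: eqP => [ji|/eqP ji]; first by rewrite ji iS in jS.
  by rewrite fx // !inE ji.
move=> j j' jS j'S; rewrite !ffunE /=.
case: eqP => [_|/eqP ji]; case: eqP => [_|/eqP j'i].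
- by rewrite e_irr.
- by rewrite e0'.
- by rewrite e_sym e0'.
- by rewrite fe // !inE ?ji ?j'i.
Qed.

Local Open Scope ring_scope.

Variable J : {set I}.
Hypothesis G_neq0 : forall i, i \in J -> G i != set0.
Hypothesis G_sparse : forall i x, i \in J -> x \in G i ->
  \sum_(j in J) #|[set y in G j | e x y]|%:R / #|G j|%:R <= 4^-1 :> rat.

(* Rosenfeld's counting form of the local lemma. *)
Lemma card_transversals_double (S : {set I}) (i : I) : S \subset J -> i \in S ->
  (#|G i| * #|transversals (S :\ i)| <= 2 * #|transversals S|)%N.
Proof.
have [m] := ubnP #|S|; elim: m S i => // m IHm S i leSm SJ iS.
have SiJ : S :\ i \subset J by apply: subset_trans SJ; apply: subD1set.
have ltS : (#|S :\ i| < m)%N by rewrite (cardsD1 i) iS in leSm.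
set q := #|transversals (S :\ i)|.
(* By induction, dropping [j] from [S :\ i] divides the count by at least [#|G j| / 2]. Sparseness
   [1/4] thus bounds the failing extensions for each [x] by [q / 2], and at least half of all
   extensions remain. *)
have bad x : x \in G i ->
   (\sum_(j in S :\ i) #|[set f in transversals (S :\ i) | e x (f j)]|)%:R
     <= q%:R / 2 :> rat.
  move=> xG; rewrite natr_sum.
  apply: (@le_trans _ _ (\sum_(j in S :\ i)
      #|[set y in G j | e x y]|%:R / #|G j|%:R * (2 * q%:R))).
    apply: ler_sum => j jS.
    have jJ := subsetP SiJ j jS.
    have Gj : 0 < #|G j|%:R :> rat by rewrite ltr0n card_gt0 G_neq0.
    apply: (@le_trans _ _ (#|[set y in G j | e x y]|%:R
                            * #|transversals (S :\ i :\ j)|%:R)).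
      by rewrite -natrM ler_nat card_transversals_through.
    rewrite -mulrA ler_wpM2l ?ler0n // ler_pdivlMl //.
    by rewrite -!natrM ler_nat IHm.
  rewrite -mulr_suml.
  have le4 : \sum_(j in S :\ i) #|[set y in G j | e x y]|%:R / #|G j|%:R <= 4^-1 :> rat.
    apply: le_trans (G_sparse (subsetP SJ i iS) xG).
    rewrite [leLHS]big_mkcond [leRHS]big_mkcond /=; apply: ler_sum => j _.
    case: ifP => [jS|_]; first by rewrite (subsetP SiJ).
    by case: ifP => // _; rewrite divr_ge0 ?ler0n.
  apply: (@le_trans _ _ (4^-1 * (2 * q%:R))); last lra.
  by rewrite ler_wpM2r // mulr_ge0 ?ler0n.
have := card_transversals_extend iS; rewrite -(ler_nat rat) natrD natr_sum natrM.
rewrite -/q => ext.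
have {}ext : #|G i|%:R * q%:R <= #|transversals S|%:R + #|G i|%:R * (q%:R / 2) :> rat.
  apply: le_trans ext _; rewrite lerD2l.
  apply: le_trans (ler_sum _ bad) _.
  by rewrite sumr_const -[leLHS]mulr_natl.
by rewrite -(ler_nat rat) !natrM; lra.
Qed.

Lemma independent_transversal : exists f : I -> T,
  (forall i, i \in J -> f i \in G i) /\
  (forall i j, i \in J -> j \in J -> ~~ e (f i) (f j)).
Proof.
suff tr_gt0 (S : {set I}) : S \subset J -> (0 < #|transversals S|)%N.
  have /card_gt0P [f /transversalsP [fG _ fe]] := tr_gt0 J (subxx J).
  by exists f.
have [m] := ubnP #|S|; elim: m S => // m IHm S leSm SJ.
have [->|[i iS]] := set_0Vmem S.
  apply/card_gt0P; exists [ffun=> x0]; apply/transversalsP.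
  by split=> [i|i _|i j]; rewrite ?inE ?ffunE.
have SiJ : S :\ i \subset J by apply: subset_trans SJ; apply: subD1set.
have ltS : (#|S :\ i| < m)%N by rewrite (cardsD1 i) iS in leSm.
have := card_transversals_double SJ iS.
have := IHm _ ltS SiJ.
have : (0 < #|G i|)%N by rewrite card_gt0 G_neq0 // (subsetP SJ).
nia.
Qed.

End IndependentTransversal.

(** * Thinning and pruning of transmitter groups *)

Lemma disjoint_parts (T : finType) (m q : nat) (X : {set T}) : m * q <= #|X| ->
  exists g : nat -> {set T},
    [/\ forall i, i < m -> g i \subset X, forall i, i < m -> #|g i| = q
      & forall i j x, i < m -> j < m -> x \in g i -> x \in g j -> i = j].
Proof.
elim: m X => [|m IHm] X leX; first by exists (fun=> set0).
have [s [s_uniq sq sX]] : exists s : seq T, [/\ uniq s, size s = q & {subset s <= X}].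
  by apply/card_geqP; apply: leq_trans leX; rewrite mulSn leq_addr.
pose Z := [set x in s].
have cZ : #|Z| = q by rewrite cardsE (card_uniqP s_uniq).
have ZX : Z \subset X by apply/subsetP => x; rewrite inE => /sX.
have [|g [gX gq gd]] := IHm (X :\: Z).
  by rewrite cardsDS // cZ; move: leX; rewrite mulSn; lia.
have gZ i x : i < m -> x \in g i -> x \in Z -> False.
  by move=> im /(subsetP (gX i im)); rewrite inE => /andP [/negP].
exists (fun i => if i == m then Z else g i); split.
- move=> i; rewrite ltnS leq_eqVlt; case: eqP => //= _ im.
  by apply: subset_trans (gX i im) (subsetDl _ _).
- by move=> i; rewrite ltnS leq_eqVlt; case: eqP => //= _; apply: gq.
- move=> i j x; rewrite !ltnS (leq_eqVlt i) (leq_eqVlt j).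
  case: eqP => [->|_] /=; case: eqP => [->|_] //=.
  + by move=> _ jm xZ /gZ xg; case: (xg jm xZ).
  + by move=> im _ /gZ xg /(xg im).
  + exact: gd.
Qed.

Section Thinning.
Variables (T : finType) (tau : nat) (Y : {set T}) (Tr : 'I_tau -> {set T}).
Variables (c : pred 'I_tau) (r : 'I_tau -> nat) (k B K R n : nat).

Hypothesis Tr_sub : forall s, Tr s \subset Y.
Hypothesis Tr_few : forall v, #|[set s | v \in Tr s]| <= k.
Hypothesis rank_lt : forall v s s', v \in Tr s -> v \in Tr s' ->
  ~~ c s -> c s' -> r s < r s'.
Hypothesis Tr_big : forall s, c s -> Tr s != set0 -> 3 * K ^ r s <= #|Tr s|.
Hypothesis Tr_small : forall s, ~~ c s -> #|Tr s| <= B * K ^ r s.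
Hypothesis rank_bound : forall s, r s < R.
Hypothesis Y_big : n * K ^ R <= #|Y|.
Hypothesis K_gt0 : 0 < K.
Hypothesis K_big : 4 * k * k.+1 * B <= K.

(** [Tr s] stands for the transmitters of slot [s], [c] for the slots declared colliding and [r] for
    their ranks. An independent transversal avoids quiet conflicts while picking three members from
    each nonempty colliding group. *)
Lemma thinning : exists V : {set T},
  [/\ V \subset Y, n <= #|V|,
      forall s, c s -> V :&: Tr s != set0 -> 2 < #|V :&: Tr s|
    & forall s, ~~ c s -> #|V :&: Tr s| <= 1].
Proof.
have [n0|n_gt0] := posnP n.
  exists set0; rewrite n0; split=> [|||s _]; rewrite ?sub0set ?set0I ?cards0 //.
  by move=> s; rewrite set0I eqxx.
have [x0 _] : exists x0, x0 \in Y.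
  apply/card_gt0P; apply: leq_trans Y_big.
  by rewrite muln_gt0 n_gt0 expn_gt0 K_gt0.
have [h [hY hK hd]] := disjoint_parts Y_big.
have /fin_all_exists [g gP] (s : 'I_tau) : exists g : nat -> {set T},
    c s -> Tr s != set0 ->
    [/\ forall i, i < 3 -> g i \subset Tr s, forall i, i < 3 -> #|g i| = K ^ r s
      & forall i j x, i < 3 -> j < 3 -> x \in g i -> x \in g j -> i = j].
  have [cs|] := boolP (c s); last by exists (fun=> set0).
  have [->|Trs] := eqVneq (Tr s) set0; first by exists (fun=> set0).
  by have [g gP] := disjoint_parts (Tr_big cs Trs); exists g.
(* Three indices per slot, for three disjoint parts of its group, and [n] further indices, for
   disjoint blocks of [Y] that make the result large. *)
pose I : finType := (('I_tau * 'I_3) + 'I_n)%type.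
pose G (j : I) : {set T} :=
  match j with inl p => g p.1 p.2 | inr i => h i end.
pose J : {set I} :=
  [set j : I | if j is inl p then c p.1 && (Tr p.1 != set0) else true].
pose e : rel T := [rel x y | (x != y)
  && [exists s, [&& ~~ c s, x \in Tr s & y \in Tr s]]].
have G_inl p y : inl p \in J -> y \in G (inl p) -> c p.1 /\ y \in Tr p.1.
  rewrite inE => /andP [cp Tp] /=; have [gTr _ _] := gP _ cp Tp.
  by move=> /(subsetP (gTr _ (ltn_ord p.2))).
(* A vertex of a quiet slot lies only in groups larger by a factor of at least [K]: colliding groups
   have higher rank, and the blocks have size [K ^ R]. *)
have G_card j y s : j \in J -> y \in G j -> ~~ c s -> y \in Tr s ->
    K ^ (r s).+1 <= #|G j|.
  case: j => [p|i] jJ yG cs ys.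
    have [cp yp] := G_inl p y jJ yG.
    move: jJ; rewrite inE => /andP [_ Tp].
    have [_ gK _] := gP _ cp Tp.
    by rewrite /G gK ?leq_pexp2l // (rank_lt ys yp).
  by rewrite /G hK ?leq_pexp2l.
(* At most one part for each of the at most [k] slots of [y], plus one block. *)
have G_few y : #|[set j in J | y \in G j]| <= k.+1.
  pose f (j : I) : option 'I_tau := if j is inl p then Some p.1 else None.
  rewrite -(card_in_imset (f := f)); last first.
    case=> [[s i]|i] [[s' i']|i']; rewrite !in_set //=.
      move=> /andP [/andP [cs Ts] yj] /andP [_ yj'] [ss'].
      rewrite -ss' in yj' *; have [_ _ gd] := gP _ cs Ts.
      congr (inl (_, _)); apply: val_inj; exact: (gd _ _ y (ltn_ord i) (ltn_ord i')).
    move=> yj yj' _; congr inr; apply: val_inj.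
    exact: (hd _ _ y (ltn_ord i) (ltn_ord i')).
  apply: leq_trans (subset_leq_card (B := None |: Some @: [set s | y \in Tr s]) _) _.
    apply/subsetP => _ /imsetP [[p|i] + ->]; rewrite !inE //=.
    move=> /andP [jJ yj]; rewrite (mem_imset _ _ Some_inj) inE.
    by apply: (G_inl p y _ yj).2; rewrite inE.
  apply: leq_trans (leq_card_setU _ _) _; rewrite cards1 add1n ltnS.
  exact: leq_trans (leq_imset_card _ _) (Tr_few y).
have [||||f [fG fe]] := @independent_transversal I T G e x0 _ _ J.
- by move=> x; rewrite /e /= eqxx.
- move=> x y; rewrite /e /= eq_sym; congr andb; apply: eq_existsb => s.
  by congr andb; rewrite andbC.
- move=> [p|i] jJ; rewrite -card_gt0 /G.
    move: jJ; rewrite inE => /andP [cp Tp]; have [_ -> //] := gP _ cp Tp.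
    by rewrite expn_gt0 K_gt0.
  by rewrite hK // expn_gt0 K_gt0.
- move=> i x _ _.
  (* Each conflict of [x] is charged to a quiet slot [s] in [Q]. There are at most [k] of these,
     each with at most [B * K ^ r s] vertices, each vertex in at most [k.+1] groups of size at least
     [K ^ (r s).+1]. The total is at most [k * k.+1 * B / K], hence [1/4] by [K_big]. *)
  pose Q := [set s | ~~ c s & x \in Tr s].
  have K0 : (0 < K%:R :> rat)%R by rewrite ltr0n.
  apply: (@le_trans _ _ (\sum_(s in Q) \sum_(y in Tr s)
     \sum_(j in [set j in J | y \in G j]) #|G j|%:R^-1)%R).
    rewrite (eq_bigr (fun s => \sum_(j in J) \sum_(y in Tr s)
        if y \in G j then #|G j|%:R^-1 else 0)%R); last first.
      move=> s _; rewrite [RHS]exchange_big /=; apply: eq_bigr => y _.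
      rewrite -big_mkcondr; apply: eq_bigl => j.
      by rewrite inE.
    rewrite exchange_big; apply: ler_sum => j _ /=.
    rewrite -[#|[set y in G j | e x y]|]sum1_card natr_sum mulr_suml.
    rewrite (eq_bigr (fun s => \sum_y
       if (y \in Tr s) && (y \in G j) then #|G j|%:R^-1 else 0)%R); last first.
      by move=> s _; rewrite -big_mkcondr big_mkcond.
    rewrite exchange_big big_mkcond /=; apply: ler_sum => y _; rewrite inE.
    have sum_ge0 (D : pred 'I_tau) : (0 <= \sum_(s in D)
        if (y \in Tr s) && (y \in G j) then #|G j|%:R^-1 else 0 :> rat)%R.
      by apply: sumr_ge0 => s _; case: ifP => // _; rewrite invr_ge0 ler0n.
    case: ifP => [|_]; last exact: sum_ge0.
    move=> /andP [yG /andP [_ /existsP [s /and3P [cs xs ys]]]].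
    rewrite (bigD1 s) /=; last by rewrite inE cs.
    rewrite ys yG mul1r lerDl sumr_ge0 // => s' _.
    by case: ifP => // _; rewrite invr_ge0 ler0n.
  apply: (@le_trans _ _ (\sum_(s in Q) (B * k.+1)%:R / K%:R)%R).
    apply: ler_sum => s; rewrite inE => /andP [cs xs].
    apply: (@le_trans _ _ (\sum_(y in Tr s) k.+1%:R / (K ^ (r s).+1)%:R)%R).
      apply: ler_sum => y ys.
      apply: (@le_trans _ _ (\sum_(j in [set j in J | y \in G j])
                               (K ^ (r s).+1)%:R^-1)%R).
        apply: ler_sum => j; rewrite inE => /andP [jJ yG].
        have Gj := G_card j y s jJ yG cs ys.
        rewrite lef_pV2 ?posrE ?ltr0n ?ler_nat ?expn_gt0 ?K_gt0 //.
        by apply: leq_trans Gj; rewrite expn_gt0 K_gt0.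
      rewrite sumr_const -[leLHS]mulr_natl ler_wpM2r ?invr_ge0 ?ler0n //.
      by rewrite ler_nat G_few.
    rewrite sumr_const -[leLHS]mulr_natl.
    apply: (@le_trans _ _ ((B * K ^ r s)%:R * (k.+1%:R / (K ^ (r s).+1)%:R))%R).
      by rewrite ler_wpM2r ?divr_ge0 ?ler0n // ler_nat Tr_small.
    rewrite expnS !natrM natrX invfM le_eqVlt; apply/orP; left; apply/eqP.
    by field; rewrite expf_neq0 ?lt0r_neq0.
  rewrite sumr_const -[leLHS]mulr_natl mulrA ler_pdivrMr // [leRHS]mulrC.
  rewrite ler_pdivlMr // -!natrM ler_nat.
  have : #|Q| <= k.
    apply: leq_trans (Tr_few x); apply/subset_leq_card/subsetP => s.
    by rewrite !inE => /andP [].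
  move: #|Q| K_big => q; clear; nia.
exists (f @: J); split.
- apply/subsetP => _ /imsetP [j jJ ->].
  case: j jJ (fG j jJ) => [p|i] jJ fj.
    by have [_ /(subsetP (Tr_sub _))] := G_inl p _ jJ fj.
  exact: (subsetP (hY _ (ltn_ord i))).
- rewrite -[leqLHS]card_ord -cardsT -(card_imset _ (@inr_inj ('I_tau * 'I_3) 'I_n)).
  have inrJ i : inr i \in J by rewrite inE.
  rewrite -(card_in_imset (f := f)).
    apply/subset_leq_card/imsetS/subsetP => _ /imsetP [i _ ->]; exact: inrJ.
  move=> _ _ /imsetP [i _ ->] /imsetP [i' _ ->] ff.
  congr inr; apply: val_inj.
  apply: (hd _ _ (f (inr i)) (ltn_ord i) (ltn_ord i') (fG _ (inrJ i))).
  by rewrite ff; exact: (fG _ (inrJ i')).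
- move=> s cs VTr.
  have Ts : Tr s != set0.
    by apply: contra_neq VTr => ->; rewrite setI0.
  have sJ i : inl (s, i) \in J by rewrite inE cs.
  have [_ _ gd] := gP s cs Ts.
  rewrite -[3]card_ord -(card_imset (f := fun i : 'I_3 => f (inl (s, i)))).
    apply/subset_leq_card/subsetP => _ /imsetP [i _ ->].
    rewrite inE imset_f //=.
    by have [] := G_inl _ _ (sJ i) (fG _ (sJ i)).
  move=> i i' ff; apply: val_inj.
  apply: (gd _ _ (f (inl (s, i))) (ltn_ord i) (ltn_ord i') (fG _ (sJ i))).
  by rewrite ff; exact: (fG _ (sJ i')).
move=> s cs; rewrite leqNgt; apply/negP => /card_gt1P [x [y [+ + xy]]].
rewrite !inE => /andP [/imsetP [j jJ xj] xs] /andP [/imsetP [j' jJ' yj] ys].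
have := fe j j' jJ jJ'; rewrite -xj -yj /e /= xy /=.
by move/existsPn/(_ s); rewrite cs xs ys.
Qed.

End Thinning.

(** Take a maximal set of groups that can be emptied at cost [E i] each. A group still meeting [Y]
    in fewer than [E i] points could be emptied too, against maximality. *)
Lemma prune (T I : finType) (X : {set T}) (Gr : I -> {set T}) (E : I -> nat) :
  exists Y : {set T}, [/\ Y \subset X, #|X| <= #|Y| + \sum_i E i
    & forall i, Y :&: Gr i != set0 -> E i <= #|Y :&: Gr i|].
Proof.
pose P (D : {set I}) := [exists Y : {set T}, [&& Y \subset X,
  #|X| <= #|Y| + \sum_(i in D) E i & [forall i in D, Y :&: Gr i == set0]]].
have P0 : P set0.
  apply/existsP; exists X; rewrite subxx leq_addr.
  by apply/forall_inP => i; rewrite inE.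
have [D /maxsetP [/existsP [Y /and3P [YX cY /forall_inP Y0]] Dmax] _] := maxset_exists P0.
exists Y; split=> //.
  by apply: leq_trans cY _; rewrite leq_add2l [leqRHS](bigID (mem D)) leq_addr.
move=> i Yi; rewrite leqNgt; apply/negP => ltE.
have iD : i \notin D by apply: contra Yi; exact: Y0.
suff /Dmax : P (i |: D).
  by move=> /(_ (subsetUr _ _)) DE; rewrite -DE setU11 in iD.
apply/existsP; exists (Y :\: Gr i); apply/and3P; split.
- exact: subset_trans (subsetDl _ _) YX.
- rewrite big_setU1 //=; apply: leq_trans cY _.
  rewrite -(cardsID (Gr i) Y); lia.
- apply/forall_inP => j; rewrite !inE => /orP [/eqP ->|/Y0 Yj].
    by rewrite setIDAC -setIDA setDv setI0.
  by rewrite setIDAC (eqP Yj) set0D.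
Qed.

(** * Executions *)

(* In-order index of the node [w] in the complete binary tree of depth [k], with
   [true] (collision) leading to the left subtree. *)
Fixpoint rank (k : nat) (w : seq bool) : nat :=
  if w is b :: w' then (if b then 0 else 2 ^ k) + rank k.-1 w' else 2 ^ k.

Lemma rank_bounds (k : nat) (w : seq bool) :
  size w <= k -> 0 < rank k w < 2 ^ k.+1.
Proof.
elim: w k => [|b w IHw] [|k] //=; first by move=> _; rewrite expn_gt0 ltn_exp2l /=.
by rewrite ltnS => /IHw; case: b; rewrite !expnS; lia.
Qed.

Lemma rank_cat_true (k : nat) (p q : seq bool) :
  size p + size q < k -> rank k (p ++ true :: q) < rank k p.
Proof.
elim: p k => [|b p IHp] [|k] //=; last by rewrite addSn ltnS ltn_add2l => /IHp.
by rewrite add0n ltnS => /rank_bounds /andP [].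
Qed.

Lemma rank_cat_false (k : nat) (p q : seq bool) :
  size p + size q < k -> rank k p < rank k (p ++ false :: q).
Proof.
elim: p k => [|b p IHp] [|k] //=; last by rewrite addSn ltnS ltn_add2l => /IHp.
by rewrite add0n ltnS => /rank_bounds /andP [h _]; rewrite -[ltnLHS]addn0 ltn_add2l.
Qed.

Definition is_collision (M : Type) (f : feedback M) : bool :=
  if f is Collision then true else false.

Definition sends (M : Type) (a : action M) : bool := isSome (sent a).

Definition collision_bits (M : Type) (h : history M) : seq bool :=
  map (@is_collision M) (pmap id h).

Section Channel.
Variables (M : Type) (N : nat) (V : {set 'I_N}) (act : 'I_N -> action M).

Let received := pmap (fun v => sent (act v)) (enum V).

Lemma size_received : size received = #|[set v in V | sends (act v)]|.
Proof.
rewrite size_pmap cardE -size_filter; apply/perm_size/uniq_perm.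
- by rewrite filter_uniq ?enum_uniq.
- exact: enum_uniq.
- by move=> v; rewrite mem_filter !mem_enum inE andbC.
Qed.

Lemma channel_silence :
  (forall v, v \in V -> ~~ sends (act v)) -> channel V act = Silence M.
Proof.
move=> noV; have := size_received; rewrite /channel -/received.
rewrite (_ : [set v in V | _] = set0); first by rewrite cards0; case: received.
by apply/setP => v; rewrite !inE; case: (boolP (v \in V)) => //= /noV /negPf.
Qed.

Lemma channel_collision :
  1 < #|[set v in V | sends (act v)]| -> channel V act = Collision M.
Proof. by rewrite -size_received /channel -/received; case: received => [|? []]. Qed.

Lemma channel_received (v : 'I_N) (m : M) :
  v \in V -> act v = Transmit m -> #|[set u in V | sends (act u)]| <= 1 ->
  channel V act = Received m.
Proof.
move=> vV actv; rewrite -size_received /channel -/received /received.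
have vE : v \in enum V by rewrite mem_enum.
case/splitPr: vE => s1 s2; rewrite pmap_cat /= actv /= size_cat /=.
by case: (pmap _ s1) (pmap _ s2) => [|? ?] [|? ?] //=; rewrite ?addnS.
Qed.

End Channel.

Section Execution.
Variables (M : Type) (N : nat) (A : algorithm M N) (V : {set 'I_N}).

Lemma size_collision_bits_extend (f : feedback M) (a : action M) (h : history M) :
  size (collision_bits (extend f a h)) = awake a + size (collision_bits h).
Proof.
rewrite /collision_bits !size_map !size_pmap.
by case: a => [||m|b] //=; rewrite -cats1 count_cat /=; lia.
Qed.

Lemma energy_size (t : nat) (v : 'I_N) :
  energy A V t v = size (collision_bits (history_at A V t v)).
Proof.
elim: t => [|t IHt]; first by rewrite /energy big_ord0.
rewrite /energy big_ord_recr /= -/(energy A V t v) IHt.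
by rewrite size_collision_bits_extend addnC.
Qed.

Lemma terminated_stable (d : 'I_N -> bool) (t u : nat) : t <= u ->
  (forall v, v \in V -> action_at A V t v = Terminate _ (d v)) ->
  forall v, v \in V -> action_at A V u v = Terminate _ (d v).
Proof.
move=> tu dt; elim: u tu => [|u IHu]; first by rewrite leqn0 => /eqP <-.
rewrite leq_eqVlt => /orP [/eqP <- //|/IHu {}IHu] v vV.
have := IHu v vV; rewrite /action_at /= => E.
by rewrite E /= E.
Qed.

End Execution.

(** There are finitely many device sets and decisions are stable, so the maximum of the election
    times serves all sets at once. *)
Lemma election_time (M : Type) (N n : nat) (A : algorithm M N) : correct n A ->
  exists t, forall V : {set 'I_N}, n <= #|V| ->
    exists2 l, l \in V & forall v, v \in V -> action_at A V t v = Terminate _ (v == l).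
Proof.
move=> corr.
have /fin_all_exists [f fP] (V : {set 'I_N}) : exists t, n <= #|V| ->
    exists2 l, l \in V & forall v, v \in V -> action_at A V t v = Terminate _ (v == l).
  have [nV|] := leqP n #|V|; last by exists 0.
  by have [t el] := corr V nV; exists t.
exists (\max_V f V) => V nV; have [l lV el] := fP V nV.
exists l => //; apply: terminated_stable el; exact: (leq_bigmax V).
Qed.

(** * The fictitious run *)

Section VirtualRun.
Variables (M : Type) (N : nat) (A : algorithm M N) (k : nat) (D : nat -> nat).

(** The fictitious run may not be a real one, so the energy bound on [A] does not apply to it. The
    cap [k] keeps ranks within the tree of depth [k]. *)
Definition eligible (h : 'I_N -> history M) (v : 'I_N) : bool :=
  awake (A v (h v)) && (size (collision_bits (h v)) < k).

(* A rank, and whether the device transmits. *)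
Definition key : finType := ('I_(2 ^ k.+1) * bool)%type.

Definition has_key (h : 'I_N -> history M) (p : key) (v : 'I_N) : bool :=
  (rank k (collision_bits (h v)) == p.1) && (sends (A v (h v)) == p.2).

(* The truncation is needed because a device can act, without being eligible,
   after its energy is spent; this does not happen in real runs. *)
Definition weight (h : 'I_N -> history M) (v : 'I_N) : nat :=
  #|key| ^ minn k (size (collision_bits (h v))).

Definition key_weight (h : 'I_N -> history M) (X : {set 'I_N}) (p : key) : nat :=
  \sum_(v in X | eligible h v && has_key h p v) weight h v.

Definition key0 : key :=
  (Ordinal (etrans (expn_gt0 2 k.+1) (erefl true)), true).

Definition best_key (h : 'I_N -> history M) (X : {set 'I_N}) : key :=
  [arg max_(p > key0) key_weight h X p].

Definition survivors (h : 'I_N -> history M) (X : {set 'I_N}) : {set 'I_N} :=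
  [set v in X | eligible h v ==> has_key h (best_key h X) v].

Definition transmitters (h : 'I_N -> history M) (X : {set 'I_N}) : {set 'I_N} :=
  [set v in survivors h X | eligible h v && sends (A v (h v))].

Definition collides (h : 'I_N -> history M) (X : {set 'I_N}) : bool :=
  D (best_key h X).1 <= #|transmitters h X|.

Definition heard (col : bool) (a : action M) : feedback M :=
  if a is Transmit m then if col then Collision M else Received m
  else Silence M.

Fixpoint run (t : nat) : ('I_N -> history M) * {set 'I_N} :=
  if t is s.+1 then
    let: (h, X) := run s in
    (fun v => extend (heard (collides h X) (A v (h v))) (A v (h v)) (h v),
     survivors h X)
  else (fun=> [::], setT).

Definition vhist (t : nat) := (run t).1.
Definition alive (t : nat) := (run t).2.
Definition vcollides (t : nat) := collides (vhist t) (alive t).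
Definition vsenders (t : nat) := transmitters (vhist t) (alive t).
Definition slot_rank (t : nat) : nat := (best_key (vhist t) (alive t)).1.

Lemma vhistS (t : nat) (v : 'I_N) : vhist t.+1 v =
  extend (heard (vcollides t) (A v (vhist t v))) (A v (vhist t v)) (vhist t v).
Proof. by rewrite /vcollides /vhist /alive /=; case: (run t). Qed.

Lemma aliveS (t : nat) : alive t.+1 = survivors (vhist t) (alive t).
Proof. by rewrite /vhist /alive /=; case: (run t). Qed.

Lemma alive_sub (t u : nat) : t <= u -> alive u \subset alive t.
Proof.
elim: u => [|u IHu]; first by rewrite leqn0 => /eqP ->.
rewrite leq_eqVlt => /orP [/eqP <- //|/IHu]; apply: subset_trans.
by rewrite aliveS; apply/subsetP => v; rewrite inE => /andP [].
Qed.

Lemma mem_vsenders (t : nat) (v : 'I_N) : (v \in vsenders t) =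
  [&& v \in alive t.+1, eligible (vhist t) v & sends (A v (vhist t v))].
Proof. by rewrite /vsenders /transmitters inE aliveS. Qed.

Lemma alive_has_key (t : nat) (v : 'I_N) : v \in alive t.+1 ->
  eligible (vhist t) v -> has_key (vhist t) (best_key (vhist t) (alive t)) v.
Proof. by rewrite aliveS inE => /andP [_ /implyP]. Qed.

Lemma vsenders_rank (t : nat) (v : 'I_N) : v \in vsenders t ->
  rank k (collision_bits (vhist t v)) = slot_rank t.
Proof.
by rewrite mem_vsenders => /and3P [va ve _]; have /andP [/eqP] := alive_has_key va ve.
Qed.

Lemma alive_homogeneous (t : nat) (u v : 'I_N) :
  u \in alive t.+1 -> eligible (vhist t) u -> v \in vsenders t -> u \in vsenders t.
Proof.
move=> ua ue; rewrite !mem_vsenders ua ue => /and3P [va ve vs].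
have /andP [_ /eqP vkey] := alive_has_key va ve.
by have /andP [_ /eqP ->] := alive_has_key ua ue; rewrite -vkey.
Qed.

Lemma collision_bitsS (t : nat) (v : 'I_N) :
  collision_bits (vhist t.+1 v) = collision_bits (vhist t v) ++
    (if awake (A v (vhist t v)) then [:: is_collision (heard (vcollides t) (A v (vhist t v)))]
     else [::]).
Proof.
rewrite vhistS /collision_bits; case: (A v _) => [||m|b] /=;
  by rewrite ?cats0 // -cats1 pmap_cat map_cat ?cats0.
Qed.

Lemma collision_bits_prefix (t u : nat) (v : 'I_N) : t <= u ->
  exists q, collision_bits (vhist u v) = collision_bits (vhist t v) ++ q.
Proof.
elim: u => [|u IHu]; first by rewrite leqn0 => /eqP ->; exists [::]; rewrite cats0.
rewrite leq_eqVlt => /orP [/eqP <-|/IHu [q qE]]; first by exists [::]; rewrite cats0.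
by eexists; rewrite collision_bitsS qE -catA.
Qed.

Lemma vsenders_bits (t : nat) (v : 'I_N) : v \in vsenders t ->
  collision_bits (vhist t.+1 v) = rcons (collision_bits (vhist t v)) (vcollides t).
Proof.
rewrite mem_vsenders => /and3P [_ _]; rewrite collision_bitsS -cats1 /sends.
by case: (A v _) => //= m _; case: (vcollides t).
Qed.

Lemma vsenders_energy (t : nat) (v : 'I_N) : v \in vsenders t ->
  size (collision_bits (vhist t v)) < k.
Proof. by rewrite mem_vsenders => /and3P [_ /andP []]. Qed.

Lemma vsenders_prefix (t u : nat) (v : 'I_N) : v \in vsenders t -> t < u ->
  exists q, collision_bits (vhist u v) = collision_bits (vhist t v) ++ vcollides t :: q.
Proof.
move=> vt tu; have [q ->] := collision_bits_prefix v tu.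
by exists q; rewrite (vsenders_bits vt) cat_rcons.
Qed.

(** The later of the two histories lies below the earlier one in the tree: in its right subtree if
    the earlier slot is quiet, in its left subtree if it collides. Either way the quiet slot comes
    first in in-order. *)
Lemma slot_rank_lt (v : 'I_N) (s t : nat) : v \in vsenders s -> v \in vsenders t ->
  ~~ vcollides s -> vcollides t -> slot_rank s < slot_rank t.
Proof.
move=> vs vt /negPf cs ct; rewrite -(vsenders_rank vs) -(vsenders_rank vt).
case: (ltngtP s t) => [st|ts|st].
- have [q qE] := vsenders_prefix vs st; have := vsenders_energy vt.
  rewrite qE cs size_cat /= => ek; apply: rank_cat_false; lia.
- have [q qE] := vsenders_prefix vt ts; have := vsenders_energy vs.
  rewrite qE ct size_cat /= => ek; apply: rank_cat_true; lia.
- by rewrite st ct in cs.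
Qed.

Lemma eligible_few (t : nat) (v : 'I_N) : \sum_(s < t) eligible (vhist s) v <= k.
Proof.
suff : \sum_(s < t) eligible (vhist s) v <= minn k (size (collision_bits (vhist t v))).
  by rewrite leq_min => /andP [].
elim: t => [|t IHt]; first by rewrite big_ord0.
rewrite big_ord_recr /= collision_bitsS size_cat.
move: IHt; rewrite /eligible; case: (awake _) => /=; last by rewrite addn0 addn0.
by case: (leqP k (size _)) => /=; lia.
Qed.

Lemma vsenders_few (tau : nat) (v : 'I_N) :
  #|[set s : 'I_tau | v \in vsenders s]| <= k.
Proof.
apply: leq_trans (eligible_few tau v).
rewrite -sum1_card big_mkcond; apply: leq_sum => s _.
by rewrite inE mem_vsenders; case: and3P => // -[_ ->].
Qed.

Lemma slot_rank_bound (t : nat) : slot_rank t < 2 ^ k.+1.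
Proof. exact: ltn_ord. Qed.

(* The class kept has at least a fraction 1/#|key| of the weight of the eligible
   devices, and spending one unit of energy multiplies weights by #|key|. *)
Lemma weight_total (t : nat) :
  \sum_(v in alive t) weight (vhist t) v <= \sum_(v in alive t.+1) weight (vhist t.+1) v.
Proof.
pose h := vhist t; pose X := alive t; pose p := best_key h X.
have key_gt0 : 0 < #|key| by apply/card_gt0P; exists key0.
have wS v : weight h v <= weight (vhist t.+1) v.
  rewrite /weight leq_pexp2l // collision_bitsS size_cat.
  by rewrite leq_min geq_minl (leq_trans (geq_minr _ _)) // leq_addr.
have wE v : eligible h v -> #|key| * weight h v = weight (vhist t.+1) v.
  move=> /andP [va vk]; rewrite /weight -expnS collision_bitsS va size_cat /=.
  by congr (_ ^ _); rewrite /h; move: vk; rewrite /h; lia.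
have heavy : \sum_(v in X | eligible h v) weight h v <= #|key| * key_weight h X p.
  have -> : \sum_(v in X | eligible h v) weight h v = \sum_q key_weight h X q.
    rewrite /key_weight (exchange_big_dep (fun v => (v \in X) && eligible h v)) /=;
      last by move=> q v _ /andP [-> /andP [-> _]].
    apply: eq_bigr => v /andP [vX ve].
    have rk : rank k (collision_bits (h v)) < 2 ^ k.+1.
      by have /andP [_ /ltnW/rank_bounds/andP []] := ve.
    rewrite (big_pred1 (Ordinal rk, sends (A v (h v)))) // => -[a b].
    rewrite /has_key vX ve /= xpair_eqE -val_eqE /=.
    by rewrite [X in X && _]eq_sym [X in _ && X]eq_sym.
  rewrite -sum_nat_const; apply: leq_sum => q _.
  by rewrite /p /best_key; case: arg_maxnP => // i _ /(_ q isT).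
rewrite (bigID (eligible h)) /= [leqRHS](bigID (eligible h)) /=.
apply: leq_add.
  apply: leq_trans heavy _; rewrite /key_weight big_distrr /=.
  rewrite aliveS [leqRHS](eq_bigl (fun v => (v \in X) && (eligible h v && has_key h p v))).
    by rewrite leq_eqVlt; apply/orP; left; apply/eqP; apply: eq_bigr => v /andP [_ /andP [/wE]].
  by move=> v; rewrite inE -andbA; case: (v \in X) => //=; case: (eligible h v); rewrite ?andbF ?andbT.
rewrite aliveS [leqRHS](eq_bigl (fun v => (v \in X) && ~~ eligible h v)).
  by apply: leq_sum => v _; apply: wS.
by move=> v; rewrite inE -andbA; case: (v \in X) => //=; case: (eligible h v); rewrite ?andbF ?andbT.
Qed.

(** The total weight starts at [N] and never decreases, and no device weighs more than
    [#|key| ^ k]. *)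
Lemma card_alive (t : nat) : N <= #|alive t| * #|key| ^ k.
Proof.
have key_gt0 : 0 < #|key| by apply/card_gt0P; exists key0.
apply: (@leq_trans (\sum_(v in alive t) weight (vhist t) v)); last first.
  rewrite -sum_nat_const; apply: leq_sum => v _.
  by rewrite /weight leq_pexp2l // geq_minl.
elim: t => [|t IHt]; last exact: leq_trans IHt (weight_total t).
rewrite -[leqLHS]card_ord -cardsT -sum1_card; apply: leq_sum => v _.
by rewrite /weight expn_gt0 key_gt0.
Qed.

(** The energy bound makes every awake device of [V] eligible, so the real transmitters are
    [V :&: vsenders t]. By homogeneity no listener survives beside a transmitter, so listeners do
    hear silence; the two size conditions give transmitters the declared feedback. *)
Lemma history_virtual (tau : nat) (V : {set 'I_N}) :
  V \subset alive tau ->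
  (forall t v, v \in V -> energy A V t v <= k) ->
  (forall s, s < tau -> vcollides s -> V :&: vsenders s != set0 ->
     1 < #|V :&: vsenders s|) ->
  (forall s, s < tau -> ~~ vcollides s -> #|V :&: vsenders s| <= 1) ->
  forall t v, t <= tau -> v \in V -> history_at A V t v = vhist t v.
Proof.
move=> Valive Venergy Vcol Vquiet; elim=> [//|t IHt] v ttau vV.
have {}IHt u : u \in V -> history_at A V t u = vhist t u.
  by move=> uV; apply: IHt => //; apply: ltnW.
pose act u := A u (history_at A V t u).
have Ve u : u \in V -> awake (act u) -> eligible (vhist t) u.
  move=> uV ua; have := Venergy t.+1 u uV.
  rewrite /energy big_ord_recr /= -/(energy A V t u) energy_size /eligible.
  by rewrite /action_at -/(act u) ua -IHt // -/(act u) ua addn1.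
have Va u : u \in V -> u \in alive t.+1.
  by move=> uV; apply: (subsetP (alive_sub ttau)); apply: (subsetP Valive).
have sendersE : [set u in V | sends (act u)] = V :&: vsenders t.
  apply/setP => u; rewrite inE in_setI mem_vsenders.
  case: (boolP (u \in V)) => //= uV; rewrite Va //= -IHt // -/(act u).
  case: (boolP (sends (act u))); rewrite ?andbF // => us.
  by rewrite Ve //; case: (act u) us.
rewrite vhistS /= -/act -/(act v) IHt //.
have actv : act v = A v (vhist t v) by rewrite /act IHt.
rewrite actv; case av : (A v (vhist t v)) => [||m|b] //=.
  congr (rcons _ (Some _)); apply: channel_silence => u uV.
  apply/negP => us.
  have : u \in V :&: vsenders t by rewrite -sendersE inE uV.
  rewrite inE => /andP [_ /alive_homogeneous hom].
  have := hom v (Va v vV); rewrite Ve ?actv ?av // => /(_ isT).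
  by rewrite mem_vsenders av /sends !andbF.
have vS : v \in V :&: vsenders t by rewrite -sendersE inE vV actv av.
congr (rcons _ (Some _)).
case: (boolP (vcollides t)) => ct.
  by apply: channel_collision; rewrite sendersE Vcol //; apply/set0Pn; exists v.
apply: (@channel_received _ _ _ _ v) => //; first by rewrite actv av.
by rewrite sendersE Vquiet.
Qed.

End VirtualRun.

(** * The lower bound *)

Section LowerBound.
Variables (M : Type) (N n : nat) (A : algorithm M N) (k : nat).
Hypothesis A_correct : correct n A.
Hypothesis A_energy : forall (V : {set 'I_N}) (t : nat) (v : 'I_N),
  n <= #|V| -> v \in V -> energy A V t v <= k.

(* The elected device can be removed from [V] without any other device noticing. *)
Lemma no_robust_set (D : nat -> nat) (tau : nat) (V : {set 'I_N}) :
  (forall W : {set 'I_N}, n <= #|W| -> exists2 l, l \in W &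
     forall v, v \in W -> action_at A W tau v = Terminate _ (v == l)) ->
  V \subset alive A k D tau -> n < #|V| ->
  (forall s, s < tau -> vcollides A k D s -> V :&: vsenders A k D s != set0 ->
     2 < #|V :&: vsenders A k D s|) ->
  (forall s, s < tau -> ~~ vcollides A k D s -> #|V :&: vsenders A k D s| <= 1) ->
  False.
Proof.
move=> elect VX nV Vcol Vquiet.
have [l lV lead] := elect V (ltnW nV).
have nVl : n <= #|V :\ l| by rewrite (cardsD1 l) lV in nV.
have [l' l'V lead'] := elect _ nVl.
have VlV : V :\ l \subset V := subD1set V l.
have l'V' := subsetP VlV _ l'V.
have hV : history_at A V tau l' = vhist A k D tau l'.
  apply: (@history_virtual _ _ A k D tau V) => // [t v|s stau cs Vs]; first by apply: A_energy; apply: ltnW.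
  exact: ltnW (Vcol s stau cs Vs).
have hVl : history_at A (V :\ l) tau l' = vhist A k D tau l'.
  have VlE s : (V :\ l) :&: vsenders A k D s = (V :&: vsenders A k D s) :\ l.
    by rewrite setIDAC.
  apply: (@history_virtual _ _ A k D tau) => //; first exact: subset_trans VlV VX.
  - by move=> t v; apply: A_energy.
  - move=> s stau cs; rewrite VlE => Vs.
    have Vs' : V :&: vsenders A k D s != set0.
      by apply: contra_neq Vs => ->; rewrite set0D.
    (* Without [l], three transmitters are still two, enough for a collision. *)
    have := Vcol s stau cs Vs'; rewrite (cardsD1 l); case: (l \in _); lia.
  - move=> s stau cs; apply: leq_trans (Vquiet s stau cs).
    by apply/subset_leq_card/setSI.
(* The leader [l'] of [V :\ l] has the same history in [V], so it is a leader there too, which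
   forces [l' = l]. *)
have := lead' l' l'V; have := lead l' l'V'.
rewrite /action_at hV hVl eqxx => -> [] /eqP l'l.
by move: l'V; rewrite l'l !inE eqxx.
Qed.

Lemma zero_energy_bound : k = 0 -> N <= n.
Proof.
move=> k0; rewrite leqNgt; apply/negP => nN.
have [tau elect] := election_time A_correct.
(* With no energy nobody is ever eligible, so all IDs survive. Threshold [0] declares every slot
   colliding, and all groups are empty. *)
have none s : vsenders A k (fun=> 0) s = set0.
  apply/setP => v; rewrite in_set0; apply/negP => /vsenders_energy.
  by rewrite [X in _ < X]k0.
apply: (@no_robust_set (fun=> 0) tau [set: 'I_N]) => //.
- have := card_alive A k (fun=> 0) tau.
  rewrite [X in _ ^ X]k0 expn0 muln1 => aN.
  suff -> : alive A k (fun=> 0) tau = [set: 'I_N] by [].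
  by apply/eqP; rewrite eqEcard subsetT cardsT card_ord.
- by rewrite cardsT card_ord.
- by move=> s _ _; rewrite none setI0 eqxx.
Qed.

(* [P] counts the classes of a slot; [L] is the factor by which a colliding group
   may shrink; [K] separates the sizes required at consecutive ranks. *)
Let P := 2 ^ k.+2.
Let L := 2 * k * P ^ k.
Let K := 4 * k * k.+1 * (3 * L).
Let R := 2 ^ k.+1.

Lemma positive_energy_bound : 0 < k -> 0 < n -> N < n * (4 * P ^ k * K ^ R).
Proof.
move=> k_gt0 n_gt0; rewrite ltnNge; apply/negP => leN.
have [tau elect] := election_time A_correct.
have P_gt0 : 0 < P ^ k by rewrite !expn_gt0.
have K_gt0 : 0 < K by rewrite /K /L !muln_gt0 /= k_gt0 P_gt0.
(* [3 * K ^ a] is the size that [thinning] asks of a colliding group; [L] is the slack that makes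
   discarding smaller remnants cheap. *)
pose D a := L * (3 * K ^ a).
pose c s := vcollides A k D s; pose S s := vsenders A k D s.
pose r s := slot_rank A k D s.
have keyE : #|key k| = P by rewrite card_prod card_ord card_bool -expnSr.
pose E (s : 'I_tau) := if c s then 3 * K ^ r s else 0.
have [Y [YX cY Ybig]] := prune (alive A k D tau) (fun s : 'I_tau => S s) E.
(* Double counting: a colliding slot has at least [L * E s] transmitters, and each device transmits
   in at most [k] slots. *)
have sumE : L * \sum_s E s <= k * N.
  apply: (@leq_trans (\sum_(s < tau) #|S s|)).
    rewrite big_distrr /=; apply: leq_sum => s _; rewrite /E.
    by case: ifP => [//|_]; rewrite muln0.
  rewrite (eq_bigr (fun s : 'I_tau => \sum_v (v \in S s))); last first.
    by move=> s _; rewrite -sum1_card big_mkcond; apply: eq_bigr => v _; case: (v \in _).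
  rewrite exchange_big mulnC /= -[X in X * k]card_ord -sum_nat_const.
  apply: leq_sum => v _; apply: leq_trans (vsenders_few A k D tau v).
  rewrite -sum1_card [leqRHS]big_mkcond; apply: eq_leq.
  by apply: eq_bigr => s _; rewrite inE; case: (v \in _).
(* As [L = 2 * k * P ^ k], pruning removes at most [N / (2 * P ^ k)] IDs, half of the guaranteed
   survivors. The target is [n.+1], at most [2 * n], because a leader is to be removed. *)
have Y_big : n.+1 * K ^ R <= #|Y|.
  have X_big := card_alive A k D tau; rewrite keyE in X_big.
  have sumE' : 2 * P ^ k * \sum_s E s <= N.
    rewrite -(leq_pmul2l k_gt0); apply: leq_trans sumE.
    by rewrite /L !mulnA [k * 2]mulnC.
  have YN : N <= 2 * P ^ k * #|Y|.
    have := leq_mul cY (leqnn (P ^ k)); nia.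
  have : 2 * P ^ k * (2 * n * K ^ R) <= 2 * P ^ k * #|Y|.
    by apply: leq_trans YN; apply: leq_trans leN; apply: eq_leq; ring.
  rewrite leq_pmul2l; last by rewrite muln_gt0.
  by apply: leq_trans; rewrite leq_mul2r; apply/orP; right; lia.
have [|||||||V [VY nV Vcol Vquiet]] := @thinning 'I_N tau Y (fun s => Y :&: S s)
    (fun s => c s) (fun s => r s) k (3 * L) K R n.+1 _ _ _ _ _ _ Y_big K_gt0.
- by move=> s; apply: subsetIl.
- move=> v; apply: leq_trans (vsenders_few A k D tau v).
  by apply/subset_leq_card/subsetP => s; rewrite !inE => /andP [].
- by move=> v s s'; rewrite !in_setI => /andP [_ +] /andP [_ +]; apply: slot_rank_lt.
- by move=> s cs /Ybig; rewrite /E cs.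
- move=> s; rewrite /c /vcollides /collides -ltnNge => /ltnW small.
  apply: leq_trans (subset_leq_card (subsetIr _ _)) _.
  by apply: leq_trans small _; rewrite /D mulnA [L * 3]mulnC.
- by move=> s; apply: slot_rank_bound.
- by [].
have VS s : V :&: (Y :&: S s) = V :&: S s by rewrite setIA (setIidPl VY).
apply: (@no_robust_set D tau V) => //.
- exact: subset_trans VY YX.
- by move=> s stau; have := Vcol (Ordinal stau); rewrite VS.
- by move=> s stau; have := Vquiet (Ordinal stau); rewrite VS.
Qed.

Lemma double_exponential_bound : 0 < k -> 0 < n -> N <= n * 2 ^ (2 ^ (7 * k)).
Proof.
move=> k_gt0 n_gt0; apply: leq_trans (ltnW (positive_energy_bound k_gt0 n_gt0)) _.
rewrite leq_mul2l; apply/orP; right.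
have k2 : k.+1 <= 2 ^ k by apply: ltn_expl.
have PE : P ^ k = 2 ^ (k.+2 * k) by rewrite /P -expnM.
have KE : K <= 2 ^ (5 + 3 * k + k.+2 * k).
  have E3 : 2 ^ (3 * k) = 2 ^ k * 2 ^ k * 2 ^ k by rewrite -!expnD; congr (2 ^ _); ring.
  rewrite (expnD 2 (5 + 3 * k)) (expnD 2 5) E3 /K /L PE.
  rewrite (_ : 4 * _ * _ * _ = 24 * (k * k * k.+1) * 2 ^ (k.+2 * k)); last by ring.
  rewrite leq_mul2r; apply/orP; right; apply: leq_mul => //.
  by do 2?apply: leq_mul => //; apply: ltnW.
apply: (@leq_trans (2 ^ (2 + k.+2 * k) * 2 ^ ((5 + 3 * k + k.+2 * k) * R))).
  rewrite expnD PE -[4]/(2 ^ 2) leq_mul2l; apply/orP; right.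
  by rewrite expnM leq_exp2r // /R expn_gt0.
rewrite -expnD leq_exp2l // /R expnS mulnC [7 * k]mulnC expnM.
(* With [x = 2 ^ k >= k.+1], the exponent is a cubic in [x], at most [16 * x ^ 3 <= x ^ 7]. *)
move: (2 ^ k) k2 => x k2.
have x2 : 2 <= x by lia.
apply: (@leq_trans (2 + (x ^ 2 - 1) + 2 * x * (x ^ 2 + 3 * x + 1))).
  apply: leq_add; first nia.
  rewrite mulnC; apply: leq_mul => //; nia.
apply: (@leq_trans (x ^ 3 * 16)); first nia.
by rewrite (expnD x 3 4) leq_mul2l (_ : 16 = 2 ^ 4) // leq_exp2r // x2 orbT.
Qed.

End LowerBound.

(** * Passage to the iterated logarithm *)

Local Open Scope ring_scope.

Lemma ln_natX2 (R : realType) (m : nat) : ln (2 ^+ m) <= m%:R :> R.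
Proof.
rewrite lnXn ?ltr0n // -[leLHS]mulr_natl ler_piMr // -[2]/(1 + 1).
by apply: le_ln1Dx; lra.
Qed.

Lemma ln_ln_le (R : realType) (x : R) (m : nat) :
  x <= 2 ^+ (2 ^ m)%N -> ln (ln x) <= m%:R.
Proof.
(* By convention [ln] is [0] on nonpositive arguments. *)
move=> xm; have [lnx|lnx] := leP (ln x) 0; first by rewrite (ln0 lnx).
have x0 : 0 < x by rewrite ltNge; apply: contraTN lnx => x0; rewrite ln0 // ltxx.
apply: le_trans (ln_natX2 R m); rewrite ler_ln ?posrE ?exprn_gt0 //.
rewrite -natrX; apply: le_trans (ln_natX2 R _).
by rewrite ler_ln ?posrE ?exprn_gt0.
Qed.

Theorem theorem4p7 (R : realType) :
  exists2 c : R, 0 < c &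
    forall (N n : nat) (M : Type) (A : algorithm M N) (k : nat),
      (0 < n <= N)%N ->
      correct n A ->
      energy_complexity n A k ->
      c * ln (ln (N%:R / n%:R)) <= k%:R.
Proof.
(* The [7] is that of the bound [N <= n * 2 ^ (2 ^ (7 * k))]. *)
exists 7^-1; first by rewrite invr_gt0 ltr0n.
move=> N n M A k /andP [n_gt0 nN] A_correct [A_energy _].
rewrite ler_pdivrMl ?ltr0n // -natrM; apply: ln_ln_le.
rewrite ler_pdivrMr ?ltr0n // mulrC -natrX -natrM ler_nat.
have [k0|k_gt0] := posnP k; last exact: double_exponential_bound A_energy k_gt0 n_gt0.
apply: leq_trans (zero_energy_bound A_correct A_energy k0) _.
by rewrite leq_pmulr // expn_gt0.
Qed.
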